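(* Let $(E,\mathcal E)$ be a Borel space and let $(\eta_t)_{t\ge 0}$ be a Markov process on $\mathbf N_{<\infty}$ with Markov semigroup $(P_t)_{t\ge 0}$ which is consistent and conservative. Then $$P_t J_n(f_n,\cdot)(\eta)=J_n\bigl(p_t^{[n]}f_n,\eta\bigr),\qquad \eta\in\mathbf N_{<\infty},$$ for each $n\in\mathbb N_0$, each $f_n\in\mathcal F_n$ and each $t\ge 0$.
   Context: $(E,\mathcal E)$ is a Borel space (measurably isomorphic, with measurable inverse, to a Borel subset of $[0,1]$). $\mathbf N_{<\infty}$ is the set of finite measures on $(E,\mathcal E)$ taking values in $\mathbb N_0=\{0,1,2,\dots\}$, with the $\sigma$-algebra $\mathcal N_{<\infty}$ generated by the maps $\eta\mapsto\eta(B)$, $B\in\mathcal E$. Every $\eta\in\mathbf N_{<\infty}$ is $0$ or of the form $\delta_{x_1}+\dots+\delta_{x_m}$ with $x_i\in E$. A Markov process on $\mathbf N_{<\infty}$ is a collection $(\Omega,\mathfrak F,(\eta_t)_{t\ge0},(\mathbb P_\eta)_{\eta\in\mathbf N_{<\infty}})$ with $\eta_t:\Omega\to\mathbf N_{<\infty}$ measurable, $\mathbb P_\eta(\eta_0=\eta)=1$, and the Markov property with respect to the natural filtration; its semigroup is $P_tf(\eta)=\mathbb E_\eta[f(\eta_t)]$. Lowering operator: $\mathcal A f(\eta):=\int f(\eta-\delta_x)\,\eta(\mathrm dx)$. It acts on the set $\mathcal G$ of measurable $f:\mathbf N_{<\infty}\to\mathbb R$ whose restriction to each $\mathbf N_n:=\{\eta\in\mathbf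 N_{<\infty}:\eta(E)=n\}$ is bounded. Consistent: $P_t\mathcal A f(\eta)=\mathcal A P_tf(\eta)$ for all $t\ge0$, all bounded measurable $f:\mathbf N_{<\infty}\to\mathbb R$ and all $\eta\in\mathbf N_{<\infty}$. Conservative: if $\eta_0\in\mathbf N_{<\infty}$ then $\eta_t(E)=\eta_0(E)$ for all $t\ge0$. $\mathcal F_n$ ($n\ge1$) is the set of bounded, measurable, permutation invariant functions $E^n\to\mathbb R$, and $\mathcal F_0:=\mathbb R$. The $n$-particle semigroup $p_t^{[n]}$ acts on $\mathcal F_n$ as follows: with $\iota_n(x_1,\dots,x_n)=\delta_{x_1}+\dots+\delta_{x_n}$, for $f_n=f\circ\iota_n$ with $f:\mathbf N_{<\infty}\to\mathbb R$ bounded measurable, $(p_t^{[n]}f_n)(x_1,\dots,x_n):=(P_tf)(\delta_{x_1}+\dots+\delta_{x_n})$ (well defined because the process is conservative); $p_t^{[0]}$ is the identity on $\mathbb R$. For $\eta=\sum_{i=1}^m\delta_{x_i}$ and $n\ge1$, the $n$-th factorial measure is $\eta^{(n)}:=\sum\delta_{(x_{i_1},\dots,x_{i_n})}$, the sum running over all $n$-tuples $(i_1,\dots,i_n)\in\{1,\dots,m\}^n$ with pairwise different entries (an empty sum is $0$). The generalized falling factorial polynomials are $J_n(f_n,\eta):=\int f_n\,\mathrm d\eta^{(n)}$ for $n\ge1$ and $J_0(f_0,\eta):=f_0$ for $f_0\in\mathbb R$. *)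

(* Defs.v *)
From HB Require Import structures.
From mathcomp Require Import all_boot all_order all_algebra perm.
From mathcomp Require Import all_classical all_reals all_analysis
  measurable_realfun.

Set Implicit Arguments.
Unset Strict Implicit.
Unset Printing Implicit Defensive.
Import Order.TTheory GRing.Theory Num.Theory.
Import numFieldNormedType.Exports.

Local Open Scope classical_set_scope.
Local Open Scope ring_scope.

Definition borel_space (R : realType) d (E : measurableType d) : Prop :=
  exists (D : set R) (phi : E -> R) (psi : R -> E),
    [/\ measurable D /\ D `<=` `[0, 1],
        (forall x, D (phi x)) /\ measurable_fun setT phi,
        measurable_fun D psi,
        cancel phi psi
      & forall r, D r -> phi (psi r) = r].

(* A library measure on [E] is a function on all subsets of [E], so two of
   them may differ only outside the sigma-algebra.  Elements of [Nfin E R] are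
   therefore required to vanish on nonmeasurable sets: each measure on the
   sigma-algebra is represented exactly once, and Leibniz equality on
   [Nfin E R] is equality of measures. *)
Record Nfin d (E : measurableType d) (R : realType) := MkNfin {
  Nfin_measure :> {measure set E -> \bar R} ;
  Nfin_nat : forall B, measurable B -> exists k : nat, Nfin_measure B = k%:R%:E ;
  Nfin_nonmeasurable : forall B, ~ measurable B -> Nfin_measure B = 0%E }.

Section restriction_to_measurable.
Context d (T : measurableType d) (R : realType) (mu : {measure set T -> \bar R}).
Local Open Scope ereal_scope.

Definition mres (B : set T) : \bar R := if `[< measurable B >] then mu B else 0.

Lemma mresE B : measurable B -> mres B = mu B.
Proof. by move=> mB; rewrite /mres; case: asboolP. Qed.

Let mres0 : mres set0 = 0.
Proof. by rewrite mresE. Qed.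

Let mres_ge0 B : 0 <= mres B.
Proof. by rewrite /mres; case: asboolP. Qed.

Let mres_sigma_additive : semi_sigma_additive mres.
Proof.
move=> F mF tF mUF; rewrite mresE//.
under eq_fun do under eq_bigr do rewrite mresE//.
exact: measure_semi_sigma_additive.
Qed.

HB.instance Definition _ := isMeasure.Build _ _ _ mres
  mres0 mres_ge0 mres_sigma_additive.

End restriction_to_measurable.

Section dirac_sum.
Context d (T : measurableType d) (R : realType).

Definition dirac_sum (s : seq T) : {measure set T -> \bar R} :=
  msum (fun k => \d_(nth point s k)) (size s).

End dirac_sum.
Arguments dirac_sum {d T} R s.

Section diracs.
Context d (E : measurableType d) (R : realType).

Let diracs_nat (s : seq E) B : measurable B ->
  exists k : nat, mres (dirac_sum R s) B = k%:R%:E.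
Proof.
move=> mB; rewrite mresE// /dirac_sum/= /msum.
exists (\sum_(k < size s) (nth point s k \in B))%N.
rewrite natr_sum -sumEFin; apply: eq_bigr => i _.
exact: diracE.
Qed.

Let diracs_nonmeasurable (s : seq E) B :
  ~ measurable B -> mres (dirac_sum R s) B = 0%E.
Proof. by rewrite /mres; case: asboolP. Qed.

(* [diracs [:: x_1; ...; x_m]] is the configuration delta_(x_1) + ... + delta_(x_m);
   on [n.-tuple E] this is the map iota_n. *)
Definition diracs (s : seq E) : Nfin E R :=
  MkNfin (@diracs_nat s) (@diracs_nonmeasurable s).

End diracs.
Arguments diracs {d E} R s.

Section Nfin_measurable.
Context d (E : measurableType d) (R : realType).

HB.instance Definition _ := gen_eqMixin (Nfin E R).
HB.instance Definition _ := gen_choiceMixin (Nfin E R).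
HB.instance Definition _ := isPointed.Build (Nfin E R) (diracs R [::]).

Definition Nfin_sigma_algebra : set (set (Nfin E R)) :=
  <<s \bigcup_(B in measurable)
        preimage_set_system setT (fun eta : Nfin E R => eta B : \bar R)
          measurable >>.

Let Nfin_measurable0 : Nfin_sigma_algebra set0.
Proof. exact: sigma_algebra0. Qed.

Let Nfin_measurableC A : Nfin_sigma_algebra A -> Nfin_sigma_algebra (~` A).
Proof. exact: sigma_algebraC. Qed.

Let Nfin_measurableU (F : (set (Nfin E R))^nat) :
  (forall i, Nfin_sigma_algebra (F i)) -> Nfin_sigma_algebra (\bigcup_i F i).
Proof. exact: sigma_algebra_bigcup. Qed.

Definition Nfin_display : measure_display.
Proof. by constructor. Qed.

HB.instance Definition _ := @isMeasurable.Build Nfin_display (Nfin E R)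
  Nfin_sigma_algebra Nfin_measurable0 Nfin_measurableC Nfin_measurableU.

End Nfin_measurable.

Section lowering_and_factorial.
Context d (E : measurableType d) (R : realType).
Implicit Types (eta : Nfin E R) (x : E).

(* eta - delta_x, i.e. the unique zeta with zeta + delta_x = eta; if x is not
   an atom of eta there is no such zeta and the value is the null measure. *)
Definition remove eta x : Nfin E R :=
  xget (diracs R [::])
    [set zeta : Nfin E R |
      forall B, measurable B -> (zeta B + \d_x B = eta B)%E].

Definition lowering (f : Nfin E R -> R) eta : R :=
  \int[Nfin_measure eta]_x f (remove eta x).

(* Some enumeration with multiplicity of the points of eta; the definitions
   below do not depend on which one. *)
Definition points eta : seq E := xget [::] [set s | eta = diracs R s].

Definition factorial_measure n eta : {measure set (n.-tuple E) -> \bar R} :=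
  dirac_sum R
    [seq [tuple nth point (points eta) (i k) | k < n]
    | i : {ffun 'I_n -> 'I_(size (points eta))} <-
        enum {: {ffun 'I_n -> 'I_(size (points eta))}} & injectiveb i].

(* A constant f_0 in F_0 = R is encoded as a function on the one-point type
   [0.-tuple E]. *)
Definition calF n (f : n.-tuple E -> R) : Prop :=
  [/\ bounded_fun f, measurable_fun setT f
    & forall (s : 'S_n) (x : n.-tuple E), f [tuple tnth x (s i) | i < n] = f x].

Definition J n (f : n.-tuple E -> R) eta : R :=
  (if n is 0 then fun f : 0.-tuple E -> R => f [tuple]
   else fun f => \int[factorial_measure _ eta]_x f x) f.

End lowering_and_factorial.

Section conditional_expectation.
Context d (Omega : measurableType d) (R : realType) (P : probability Omega R).

(* Y is a version of the conditional expectation of Z given the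
   sub-sigma-algebra G. *)
Definition is_cond_expectation (G : set (set Omega)) (Z Y : Omega -> R) : Prop :=
  [/\ forall B : set R, measurable B -> G (Y @^-1` B),
      P.-integrable setT (EFin \o Y)
    & forall A, G A -> \int[P]_(w in A) Y w = \int[P]_(w in A) Z w].

End conditional_expectation.

Section process.
Context d (E : measurableType d) (R : realType).
Context d' (Omega : measurableType d').
Variables (X : R -> Omega -> Nfin E R) (P : Nfin E R -> probability Omega R).

Definition semigroup (t : R) (f : Nfin E R -> R) (eta : Nfin E R) : R :=
  fine 'E_(P eta)[f \o X t].

Definition natural_filtration (s : R) : set (set Omega) :=
  <<s \bigcup_(u in `[0, s]) preimage_set_system setT (X u) measurable >>.

Record is_markov_process : Prop := {
  markov_measurable : forall t, 0 <= t -> measurable_fun setT (X t) ;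
  markov_initial : forall eta, P eta [set w | X 0 w = eta] = 1%E ;
  markov_property : forall eta s t (f : Nfin E R -> R), 0 <= s -> 0 <= t ->
    bounded_fun f -> measurable_fun setT f ->
    is_cond_expectation (P eta) (natural_filtration s)
      (f \o X (s + t)) (semigroup t f \o X s) }.

Definition consistent : Prop :=
  forall t (f : Nfin E R -> R) eta, 0 <= t ->
    bounded_fun f -> measurable_fun setT f ->
    semigroup t (lowering f) eta = lowering (semigroup t f) eta.

Definition conservative : Prop :=
  forall eta t, 0 <= t -> {ae P eta, forall w, X t w setT = X 0 w setT}.

(* Some bounded measurable f with f_n = f \o iota_n. *)
Definition lift_Nfin n (fn : n.-tuple E -> R) : Nfin E R -> R :=
  xget (cst 0) [set f : Nfin E R -> R | [/\ bounded_fun f, measurable_fun setT f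
                          & forall x : n.-tuple E, fn x = f (diracs R x)]].

Definition particle_semigroup (t : R) n (fn : n.-tuple E -> R) : n.-tuple E -> R :=
  if n is 0 then fn else fun x => semigroup t (lift_Nfin fn) (diracs R x).

End process.

(* Main.v *)
(* Write f_n = h o iota_n with h supported on N_n.  Iterating the lowering
   operator, A^k h (eta) sums h over the k! orderings in which k of the n + k
   points of eta can be deleted, so J_n(f_n, .) = n!/k! A^k h on N_(n+k).  As A
   maps bounded functions supported on N_m to bounded functions supported on
   N_(m+1), consistency can be iterated: P_t A^k h = A^k P_t h.  Conservativity
   confines eta_t to N_(n+k), where A^k P_t h is a multiple of
   J_n(p_t^[n] f_n, .).  The Borel structure of E serves to enumerate the points
   of a configuration measurably. *)

Require Import Defs.
From mathcomp Require Import all_boot all_order all_algebra perm.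
From mathcomp Require Import all_classical all_reals all_analysis
  measurable_realfun.

Set Implicit Arguments.
Unset Strict Implicit.
Unset Printing Implicit Defensive.
Import Order.TTheory GRing.Theory Num.Theory.
Import numFieldNormedType.Exports.

Local Open Scope classical_set_scope.
Local Open Scope ring_scope.

(** * Integration against finite sums of Dirac masses *)

Section integral_dirac_sum.
Context d (T : measurableType d) (R : realType).
Implicit Types (s : seq T) (mu : {measure set T -> \bar R}).

Lemma dirac_sumE s (B : set T) :
  dirac_sum R s B = (\sum_(x <- s) (x \in B)%:R)%:E.
Proof.
rewrite /dirac_sum/= /msum (big_nth point) big_mkord -sumEFin.
by apply: eq_bigr => i _; exact: diracE.
Qed.

Context (mset1 : forall x : T, measurable [set x]).

Lemma ge0_measurable_integral_dirac_sum mu s (f : T -> \bar R) :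
  (forall B, measurable B -> mu B = dirac_sum R s B) ->
  (forall x, 0 <= f x)%E -> measurable_fun setT f ->
  (\int[mu]_x f x = \sum_(x <- s) f x)%E.
Proof.
move=> muE f0 mf.
rewrite (eq_measure_integral (dirac_sum R s)); last by move=> A mA _; exact: muE.
rewrite /dirac_sum ge0_integral_measure_sum// (big_nth point) big_mkord.
by apply: eq_bigr => i _; rewrite integral_dirac// diracT mul1e.
Qed.

Import HBNNSimple.

(** The integral is a supremum over simple functions below [f]. Each of them is measurable, so its
    integral is a sum over [s] bounded by that of [f]. Conversely, [f] set to 0 off [s] is
    measurable because points are, lies below [f], and already attains the sum. *)
Lemma ge0_integral_dirac_sum mu s (f : T -> \bar R) :
  (forall B, measurable B -> mu B = dirac_sum R s B) ->
  (forall x, 0 <= f x)%E -> (\int[mu]_x f x = \sum_(x <- s) f x)%E.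
Proof.
move=> muE f0; apply/eqP; rewrite eq_le; apply/andP; split.
  rewrite ge0_integralTE//; apply: ge_ereal_sup => /= _ [h /= hf <-].
  rewrite -integralT_nnsfun (ge0_measurable_integral_dirac_sum muE)//.
  - by apply: lee_sum => x _; exact: hf.
  - by move=> x; rewrite lee_fin.
  - exact/measurable_EFinP.
have ms : measurable [set` s].
  rewrite (_ : [set` s] = \bigcup_(x in [set` s]) [set x]).
    apply: fin_bigcup_measurable => //; exact: finite_seq.
  by apply/seteqP; split => [x xs|x [y ys ->]//]; exists x.
pose g x := if x \in s then f x else 0%E.
have g0 x : (0 <= g x)%E by rewrite /g; case: ifP.
have gf x : (g x <= f x)%E by rewrite /g; case: ifP.
have mg : measurable_fun setT g.
  move=> _ Y mY; rewrite setTI.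
  rewrite (_ : _ @^-1` _ = (\bigcup_(x in [set` [seq x <- s | `[<Y (f x)>]]]) [set x])
     `|` (~` [set` s] `&` [set x | Y 0%E])).
    apply: measurableU.
      by apply: fin_bigcup_measurable => //; exact: finite_seq.
    apply: measurableI; first exact: measurableC.
    have [Y0|Y0] := pselect (Y 0%E).
      by rewrite (_ : [set _ | _] = setT)//; apply/seteqP; split.
    by rewrite (_ : [set _ | _] = set0)//; apply/seteqP; split.
  apply/seteqP; split => x /=; rewrite /g.
    case: ifPn => xs Yx; last by right; split => //; exact/negP.
    by left; exists x => //=; rewrite mem_filter xs andbT; apply/asboolP.
  move=> [[y /= + ->]|[/negP/negbTE -> //]].
  by rewrite mem_filter => /andP[/asboolP ? ->].
apply: (@le_trans _ _ (\int[mu]_x g x)%E).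
  rewrite (ge0_measurable_integral_dirac_sum muE)// le_eqVlt; apply/orP; left.
  by apply/eqP; rewrite !big_seq; apply: eq_bigr => x xs; rewrite /g xs.
rewrite !ge0_integralTE//; apply: ge_ereal_sup => /= _ [h /= hg <-].
apply: ereal_sup_ubound; exists h => //= x.
exact: le_trans (hg x) (gf x).
Qed.

(* [f] need not be measurable: nothing says that [P_t f] is measurable in the
   initial configuration. *)
Lemma Rintegral_dirac_sum mu s (f : T -> R) :
  (forall B, measurable B -> mu B = dirac_sum R s B) ->
  \int[mu]_x f x = \sum_(x <- s) f x.
Proof.
move=> muE; rewrite /Rintegral integralE.
rewrite !(ge0_integral_dirac_sum muE)//.
(* Negative parts of a real-valued function are finite, so the difference of the two sums can be
   recombined term by term. *)
rewrite -fin_num_sumeN; last first.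
  by move=> x _; rewrite funenegE /=; case: ltgtP.
rewrite -big_split/= -[RHS]/(fine (_%:E)) -sumEFin; congr fine.
apply: eq_bigr => x _; by have /(congr1 (@^~ x))/= <- := funeposneg (EFin \o f).
Qed.

End integral_dirac_sum.

(** * Configurations as lists up to order, and the lowering operator on them *)

Section configurations.
Context d (E : measurableType d) (R : realType).
Implicit Types (s : seq E) (x : E) (eta zeta : Nfin E R).

Lemma Nfin_ext eta zeta : (forall B, measurable B -> eta B = zeta B) -> eta = zeta.
Proof.
case: eta zeta => [m1 n1 v1] [m2 n2 v2] /= m12.
have {}m12 : m1 = m2.
  apply: eq_measure; apply/funext => B; have [/m12//|nB] := pselect (measurable B).
  by rewrite v1 ?v2.
move: n2 v2; rewrite -m12 => n2 v2.
by rewrite (Prop_irrelevance n1 n2) (Prop_irrelevance v1 v2).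
Qed.

Lemma diracsE s B : measurable B ->
  diracs R s B = (\sum_(x <- s) (x \in B)%:R)%:E.
Proof. by move=> mB; rewrite -dirac_sumE; exact: mresE. Qed.

Lemma diracsT s : diracs R s setT = (size s)%:R%:E.
Proof.
rewrite diracsE//; under eq_bigr do rewrite in_setT.
by rewrite big_const_seq count_predT iter_addr_0.
Qed.

Lemma perm_diracs s s' : perm_eq s s' -> diracs R s = diracs R s'.
Proof.
by move=> ss'; apply: Nfin_ext => B mB; rewrite !diracsE//; congr EFin; exact: perm_big.
Qed.

(** All values are natural numbers, hence finite, so the Dirac mass cancels and the choice made by
    [xget] is forced. *)
Lemma remove_unique eta zeta x :
  (forall B, measurable B -> (zeta B + \d_x B = eta B)%E) -> remove eta x = zeta.
Proof.
move=> zE; apply: xget_unique => //= y yE; apply: Nfin_ext => B mB.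
have := zE B mB; rewrite -(yE B mB) diracE.
have [k ->] := Nfin_nat zeta mB; have [l ->] := Nfin_nat y mB.
by rewrite -!EFinD => -[/addIr ->].
Qed.

Lemma remove_diracs s x : x \in s -> remove (diracs R s) x = diracs R (rem x s).
Proof.
move=> xs; apply: remove_unique => B mB.
rewrite (perm_diracs (perm_to_rem xs)) !diracsE// diracE -EFinD.
by rewrite big_cons addrC.
Qed.

Context (mset1 : forall x : E, measurable [set x]).

(** The mass of a singleton is the multiplicity of its point in the list. *)
Lemma diracs_perm s s' : diracs R s = diracs R s' -> perm_eq s s'.
Proof.
move=> ss'; apply/allP => x _ /=; apply/eqP.
have : diracs R s [set x] = diracs R s' [set x] by rewrite ss'.
rewrite !diracsE// => -[].
have cE t : \sum_(y <- t) (y \in [set x])%:R = (count_mem x t)%:R :> R.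
  rewrite -sum1_count natr_sum [RHS]big_mkcond/=.
  by apply: eq_bigr => y _; case: eqP => [->|yx]; [rewrite mem_set|rewrite memNset].
by rewrite !cE => /eqP; rewrite eqr_nat => /eqP.
Qed.

Lemma lowering_diracs (g : Nfin E R -> R) s :
  lowering g (diracs R s) = \sum_(x <- s) g (diracs R (rem x s)).
Proof.
rewrite /lowering (Rintegral_dirac_sum mset1 (s := s)); last first.
  by move=> B mB; rewrite diracsE// dirac_sumE.
by rewrite !big_seq; apply: eq_bigr => x xs; rewrite remove_diracs.
Qed.

(** Points are indexed by ordinals so that repeated points stay distinct and deleting the [j]-th one
    is composition with [lift j]. *)
Lemma lowering_codom (g : Nfin E R -> R) m (x : 'I_m.+1 -> E) :
  lowering g (diracs R (codom x)) = \sum_j g (diracs R (codom (x \o lift j))).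
Proof.
rewrite lowering_diracs big_map big_enum/=; apply: eq_bigr => j _; congr g.
apply: perm_diracs; rewrite -(perm_cons (x j)) perm_sym.
have /(perm_map x) : perm_eq (enum 'I_m.+1) (j :: [seq lift j k | k <- enum 'I_m]).
  apply: uniq_perm; first exact: enum_uniq.
    rewrite /= map_inj_uniq ?enum_uniq ?andbT; last exact: lift_inj.
    by apply/mapP => -[k _ /eqP]; rewrite (negbTE (neq_lift _ _)).
  move=> k; rewrite mem_enum inE; have [->|kj] := eqVneq k j; first by rewrite !inE eqxx.
  rewrite inE; case: (unliftP j k) kj => [l ->|->]; last by rewrite eqxx.
  by rewrite mem_map ?mem_enum ?inE ?orbT//; exact: lift_inj.
rewrite /= -map_comp perm_sym => /perm_trans; apply; apply: perm_to_rem.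
by apply/mapP; exists j => //; rewrite mem_enum.
Qed.

End configurations.

(** Double counting: an injection factors through [lift j] exactly when it misses [j], and an
    injection of [n] indices into [m.+1] misses [m.+1 - n] of them. *)
Lemma sum_injections_lift (R : pzSemiRingType) n m (F : {ffun 'I_n -> 'I_m.+1} -> R) :
  \sum_(j < m.+1) \sum_(i : {ffun 'I_n -> 'I_m} | injectiveb i)
    F [ffun k => lift j (i k)] =
  (\sum_(i : {ffun 'I_n -> 'I_m.+1} | injectiveb i) F i) *+ (m.+1 - n).
Proof.
pose L (j : 'I_m.+1) (i : {ffun 'I_n -> 'I_m}) := [ffun k => lift j (i k)].
have Linj j : injective (L j).
  move=> i i' /ffunP ii'; apply/ffunP => k; have := ii' k.
  by rewrite !ffunE => /lift_inj.
have LE j (i : {ffun 'I_n -> 'I_m.+1}) :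
    (i \in [set L j i' | i' : {ffun 'I_n -> 'I_m} & injectiveb i']%SET) =
    injectiveb i && (j \notin codom i).
  apply/imsetP/andP => [[i' + ->]|[/injectiveP iinj jNi]].
    rewrite inE => /injectiveP i'inj; split.
      by apply/injectiveP => k l; rewrite !ffunE => /lift_inj/i'inj.
    by apply/codomP => -[k]; rewrite ffunE => /eqP; rewrite (negbTE (neq_lift _ _)).
  have /fin_all_exists[f fE] : forall k, exists l, i k = lift j l.
    move=> k; case: (unliftP j (i k)) => [l ->|ik]; first by exists l.
    by move: jNi; rewrite -ik codom_f.
  exists [ffun k => f k]; last by apply/ffunP => k; rewrite !ffunE.
  rewrite inE; apply/injectiveP => k l; rewrite !ffunE => fkl.
  by apply: iinj; rewrite !fE fkl.
transitivity (\sum_(j < m.+1) \sum_(i : {ffun 'I_n -> 'I_m.+1} |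
    injectiveb i && (j \notin codom i)) F i).
  apply: eq_bigr => j _; under [RHS]eq_bigl do rewrite -LE.
  rewrite big_imset/=; last by move=> ? ? _ _; exact: Linj.
  by apply: eq_bigl => i; rewrite inE.
rewrite (exchange_big_dep (fun i : {ffun 'I_n -> 'I_m.+1} => injectiveb i))/=; last first.
  by move=> j i _ /andP[].
rewrite -sumrMnl; apply: eq_bigr => i iinj.
under eq_bigl do rewrite iinj /=.
rewrite sumr_const; congr (_ *+ _).
have /injectiveP/card_codom := iinj; rewrite card_ord => ci.
have := cardC (mem (codom i)); rewrite card_ord [X in (X + _)%N]ci => cE.
by rewrite -[X in (X - n)%N]cE addKn.
Qed.

(** * Falling factorial polynomials as iterates of the lowering operator *)

Section factorial_sums.
Context d (E : measurableType d) (R : realType).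
Implicit Types (s : seq E) (eta : Nfin E R) (h : Nfin E R -> R).
Context (mset1 : forall x : E, measurable [set x]).

(** The factor [n!] counts the orderings of the surviving points, [k!] those of the deleted ones.
    For [k = 0] the injections are the permutations of the indices, and [h] does not see the
    order. *)
Lemma iter_lowering_codom h n k m (x : 'I_m -> E) : m = (k + n)%N ->
  k`!%:R * (\sum_(i : {ffun 'I_n -> 'I_m} | injectiveb i) h (diracs R (codom (x \o i)))) =
  n`!%:R * iter k (@lowering d E R) h (diracs R (codom x)).
Proof.
elim: k m x => [m x|k IHk [//|m] x [mE]].
  rewrite add0n => mn; move: x; rewrite mn => x {mn}.
  rewrite fact0 mul1r /= (eq_bigr (fun=> h (diracs R (codom x)))).
    by rewrite sumr_const mulr_natl -cardsE card_inj_ffuns card_ord ffactnn.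
  move=> i /injectiveP iinj; congr h; apply: perm_diracs.
  rewrite !codomE map_comp; apply: perm_map; apply: uniq_perm.
  - by rewrite map_inj_uniq ?enum_uniq.
  - exact: enum_uniq.
  - move=> j; rewrite mem_enum inE -[j in LHS](f_finv iinj).
    by rewrite mem_map ?mem_enum.
(* This is the number of indices missed by an injection, so the factor [k.+1] of the factorial is
   the one produced by [sum_injections_lift]. *)
have kE : k.+1 = (m.+1 - n)%N by rewrite mE -addSn addnK.
rewrite factS natrM -mulrA mulrCA (mulr_natl _ k.+1) [X in _ * (_ *+ X) = _]kE.
rewrite -sum_injections_lift [iter _ _ _]/= lowering_codom// !mulr_sumr.
apply: eq_bigr => j _; rewrite -(IHk _ _ mE); congr (_ * _).
apply: eq_bigr => i _; congr (h (diracs R _)).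
by apply: eq_map => l /=; rewrite ffunE.
Qed.

Lemma measurable_tuple1 n (y : n.-tuple E) : measurable [set y].
Proof.
rewrite (_ : [set y] = \bigcap_(i in [set: 'I_n]) [set z | tnth z i = tnth y i]).
  apply: fin_bigcap_measurable => // i _.
  rewrite -[X in measurable X]setTI.
  exact: (@measurable_tnth _ _ _ i measurableT _ (mset1 (tnth y i))).
apply/seteqP; split => [_ -> //|z zy].
by apply/eq_from_tnth => i; exact: zy.
Qed.

Lemma J_points n (fn : n.-tuple E -> R) eta : (0 < n)%N ->
  J fn eta = \sum_(i : {ffun 'I_n -> 'I_(size (points eta))} | injectiveb i)
               fn [tuple nth point (points eta) (i k) | k < n].
Proof.
case: n fn => // n fn _; rewrite /J /factorial_measure.
rewrite (Rintegral_dirac_sum (@measurable_tuple1 _) _ (fun _ _ => erefl)).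
by rewrite big_map big_filter big_enum_cond.
Qed.

Lemma points_diracs s : diracs R (points (diracs R s)) = diracs R s.
Proof.
apply/esym.
exact: (@xgetPex _ [::] [set t | diracs R s = diracs R t] (ex_intro _ s erefl)).
Qed.

(** [J] uses the enumeration chosen by [points]. By [diracs_perm] it has as many entries as [s], so
    the injection count applies to it. *)
Lemma J_lowering n (fn : n.-tuple E -> R) h k s : (0 < n)%N ->
  (forall y : n.-tuple E, fn y = h (diracs R y)) -> size s = (k + n)%N ->
  J fn (diracs R s) = n`!%:R / k`!%:R * iter k (@lowering d E R) h (diracs R s).
Proof.
move=> n0 fnE sE; rewrite J_points//.
have ps := points_diracs s; rewrite -[in RHS]ps.
have := perm_size (diracs_perm mset1 ps); rewrite sE.
move: (points _) => p pE.
pose x i := nth point p (i : 'I_(size p)).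
have px : codom x = p.
  rewrite -[RHS](mkseq_nth point) codomE /mkseq -val_enum_ord -map_comp.
  exact: eq_map.
rewrite -[in RHS]px mulrAC -(iter_lowering_codom h x pE) mulrAC mulfV ?mul1r; last first.
  by rewrite pnatr_eq0 -lt0n fact_gt0.
by apply: eq_bigr => i _; rewrite fnE; congr (h (diracs R _)).
Qed.


Lemma J_small n (fn : n.-tuple E -> R) s : (size s < n)%N -> J fn (diracs R s) = 0.
Proof.
move=> sn; rewrite J_points ?(leq_ltn_trans _ sn)//.
rewrite big_pred0// => i; apply/negP => /injectiveP/leq_card.
by rewrite !card_ord (perm_size (diracs_perm mset1 (points_diracs s))) leqNgt sn.
Qed.

End factorial_sums.

(** * Measurability of maps from and to the space of configurations *)

Section measurability_on_Nfin.
Context d (E : measurableType d) (R : realType).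
Implicit Types (eta : Nfin E R).

Lemma measurable_eval B : measurable B ->
  measurable_fun setT (fun eta : Nfin E R => eta B).
Proof.
move=> mB _ Y mY; apply: sub_sigma_algebra; exists B => //.
by exists Y.
Qed.

Lemma measurable_to_Nfin d' (T : measurableType d') (F : T -> Nfin E R) :
  (forall B, measurable B -> measurable_fun setT (fun t => F t B)) ->
  measurable_fun setT F.
Proof.
move=> mF; apply: (@measurability _ _ _ _ _ _ (\bigcup_(B in measurable)
  preimage_set_system setT (fun eta : Nfin E R => eta B : \bar R) measurable)) => //.
by move=> _ [_ [B mB [Y mY <-]] <-]; rewrite !setTI -[X in measurable X]setTI; exact: mF.
Qed.

Lemma measurable_eval_eq B (y : \bar R) : measurable B ->
  measurable [set eta : Nfin E R | eta B = y].
Proof.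
move=> mB; rewrite -[X in measurable X]setTI.
exact: (measurable_eval mB measurableT (emeasurable_set1 y)).
Qed.

(** Integer values leave a gap above 0, so that nonzero masses cannot tend to 0. *)
Lemma Nfin_ge1 eta B : measurable B -> eta B != 0%E -> (1 <= eta B)%E.
Proof.
move=> mB; have [[|k] ->] := Nfin_nat eta mB; first by rewrite eqxx.
by rewrite lee_fin ler1n.
Qed.

Lemma Nfin_fin_num eta B : measurable B -> eta B \is a fin_num.
Proof. by move=> mB; have [k ->] := Nfin_nat eta mB. Qed.

End measurability_on_Nfin.

(** * Measurable choice of an atom in a Borel space *)

Section borel_spaces.
Context d (E : measurableType d) (R : realType).
Implicit Types (eta : Nfin E R).

Lemma borel_space_measurable1 : borel_space R E -> forall x : E, measurable [set x].
Proof.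
move=> [D [phi [psi [[mD D01] [Dphi mphi] mpsi phiK psiK]]]] x.
rewrite (_ : [set x] = setT `&` phi @^-1` [set phi x]); first exact: mphi.
rewrite setTI; apply/seteqP; split => [_ -> //|y /= /(congr1 psi)].
by rewrite !phiK.
Qed.

(* The atom is the one with the smallest coordinate [q eta] in [0, 1]. *)
Lemma borel_space_atom : borel_space R E -> exists a : Nfin E R -> E,
  measurable_fun setT a /\ forall eta, eta setT != 0%E -> eta [set a eta] != 0%E.
Proof.
move=> [D [phi [psi [[mD D01] [Dphi mphi] mpsi phiK psiK]]]].
pose H r := phi @^-1` `]-oo, r].
have mH r : measurable (H r) by rewrite -[H r]setTI; exact: mphi.
pose q eta := inf [set r | eta (H r) != 0%E].
(* The infimum is attained: the sets [F n] decrease to [H (q eta)] and each has mass at least 1, so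
   by continuity from above the limit has mass at least 1 too. *)
have qE eta r : eta setT != 0%E -> (q eta <= r) = (eta (H r) != 0%E).
  move=> eta0; set S := [set r | eta (H r) != 0%E].
  have Sup r1 r2 : S r1 -> r1 <= r2 -> S r2.
    move=> Sr1 r12; apply/eqP => Hr2; move/negP: Sr1; apply.
    rewrite eq_le measure_ge0 andbT -Hr2 le_measure ?inE//.
    by move=> x; rewrite /H /= !in_itv/= => /le_trans; apply.
  have S1 : S 1.
    rewrite /S/= (_ : H 1 = setT)//; apply/seteqP; split => // x _.
    by rewrite /H /= in_itv/=; have /andP[] := D01 _ (Dphi x).
  have S0 : lbound S 0.
    move=> s Ss; rewrite leNgt; apply/negP => s0; move/eqP: Ss; apply.
    rewrite (_ : H s = set0) ?measure0//; apply/seteqP; split => // x.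
    rewrite /H /= in_itv/= => xs; have /andP[x0 _] := D01 _ (Dphi x).
    by have := lt_le_trans (le_lt_trans xs s0) x0; rewrite ltxx.
  have Sinf : has_inf S by split; [exists 1|exists 0].
  apply/idP/idP; last by move=> Sr; apply: ge_inf => //; exists 0.
  suff Sq : S (q eta) by exact: (Sup _ _ Sq).
  pose F (n : nat) := H (q eta + n.+1%:R^-1).
  have SF n : eta (F n) != 0%E.
    have [s Ss /ltW] : exists2 s, S s & s < inf S + n.+1%:R^-1.
      by apply: inf_adherent => //; rewrite invr_gt0.
    exact: Sup.
  have HF : H (q eta) = \bigcap_n F n.
    apply/seteqP; split => [x /= + n _|x Fx]; rewrite /F /H /= !in_itv/=.
      by move=> /le_trans; apply; rewrite lerDl invr_ge0.
    rewrite leNgt; apply/negP => /ltr_add_invr[n qn].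
    by have := Fx n I; rewrite /F /H /= in_itv/= leNgt qn.
  have cF : eta \o F @ \oo --> eta (H (q eta)).
    rewrite HF; apply: nonincreasing_cvg_mu => //.
    - by rewrite ltey_eq Nfin_fin_num// /F.
    - by move=> i; exact: mH.
    - by rewrite -HF.
    - move=> m n mn; apply/subsetPset => x; rewrite /F /H /= !in_itv/= => /le_trans.
      by apply; rewrite lerD2l lef_pV2 ?posrE// ler_nat.
  rewrite /S /= gt_eqF// (@lt_le_trans _ _ 1%E)// -(cvg_lim _ cF)//.
  apply: lime_ge; first by apply/cvg_ex; exists (eta (H (q eta))).
  by apply: nearW => n; apply: Nfin_ge1 => //; exact: mH.
have mq : measurable_fun setT q.
  apply: (measurability _ (RGenOInfty.measurableE R)) => _ [_ [r ->] <-].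
  (* By [qE], [q] exceeds [r] exactly when [H r] is null. The null configuration is treated apart:
     there [q] is the infimum of the empty set, which is 0. *)
  rewrite setTI (_ : q @^-1` _ =
    ([set eta : Nfin E R | eta (H r) = 0%E] `&` ~` [set eta : Nfin E R | eta setT = 0%E]) `|`
    ([set eta : Nfin E R | eta setT = 0%E] `&` [set _ : Nfin E R | r < 0])).
    apply: measurableU; apply: measurableI.
    - exact: measurable_eval_eq.
    - by apply: measurableC; exact: measurable_eval_eq.
    - exact: measurable_eval_eq.
    - have [r0|r0] := boolP (r < 0).
        by rewrite (_ : [set _ | _] = setT)//; apply/seteqP; split.
      by rewrite (_ : [set _ | _] = set0)//; apply/seteqP; split.
  have q0 eta : eta setT = 0%E -> q eta = 0.
    move=> eta0; rewrite /q (_ : [set _ | _] = set0) ?inf0//.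
    apply/seteqP; split => // s /= /negP; apply.
    by rewrite eq_le measure_ge0 andbT -eta0 le_measure ?inE.
  apply/seteqP; split => eta /=; rewrite in_itv/= andbT.
    have [eta0|/eqP eta0] := eqVneq (eta setT) 0%E; first by rewrite q0//; right.
    by rewrite ltNge qE ?negbK; [move/eqP; left|exact/eqP].
  move=> [[/eqP Hr /eqP eta0]|[/q0 -> //]].
  by rewrite ltNge qE ?negbK.
have atom eta : eta setT != 0%E -> eta (phi @^-1` [set q eta]) != 0%E.
  move=> eta0; have mq1 : measurable (phi @^-1` [set q eta]).
    by rewrite -[X in measurable X]setTI; exact: mphi.
  apply/eqP => /(negligibleP _ mq1) n1.
  have := lexx (q eta); rewrite qE// => /negP; apply.
  apply/eqP/(negligibleP _ (mH _)).
  (* Coordinates strictly below [q eta] form a countable union of null sets, by minimality. If the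
     level [q eta] were null as well, so would be [H (q eta)], against [qE]. *)
  rewrite (_ : H (q eta) =
    phi @^-1` [set q eta] `|` \bigcup_n H (q eta - n.+1%:R^-1)).
    apply: negligibleU => //; apply: negligible_bigcup => n.
    apply/negligibleP => //; apply/eqP; rewrite -[_ == _]negbK -qE// -ltNge.
    by rewrite ltrBlDr ltrDl invr_gt0.
  apply/seteqP; split => x; rewrite /H /= in_itv/=.
    rewrite le_eqVlt => /predU1P[->|]; first by left.
    move=> /ltr_add_invr[n qn]; right; exists n => //.
    by rewrite /= in_itv/= lerBrDr ltW.
  move=> [->//|[n _]]; rewrite /= in_itv/= => /le_trans; apply.
  by rewrite lerBlDr lerDl invr_ge0.
have atomP eta : eta setT != 0%E -> exists x, phi x = q eta.
  move=> /atom; apply: contra_neqP => nq.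
  rewrite (_ : _ @^-1` _ = set0) ?measure0//; apply/seteqP; split => // x xq.
  by apply: nq; exists x.
(* As [psi] is controlled only on [D], it is applied only to nonnull configurations, where [atomP]
   places [q eta] in the range of [phi]. *)
exists (fun eta => if eta setT == 0%E then point else psi (q eta)); split.
  move=> _ Y mY; rewrite setTI (_ : _ @^-1` Y =
    ([set eta : Nfin E R | eta setT = 0%E] `&` [set _ : Nfin E R | Y point]) `|`
    (~` [set eta : Nfin E R | eta setT = 0%E] `&` q @^-1` (D `&` psi @^-1` Y))).
    apply: measurableU; apply: measurableI.
    - exact: measurable_eval_eq.
    - have [r0|r0] := pselect (Y point).
        by rewrite (_ : [set _ | _] = setT)//; apply/seteqP; split.
      by rewrite (_ : [set _ | _] = set0)//; apply/seteqP; split.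
    - by apply: measurableC; exact: measurable_eval_eq.
    - by rewrite -[X in measurable X]setTI; apply: mq => //; exact: mpsi.
  apply/seteqP; split => eta /=; case: eqP => [eta0|/eqP eta0].
  - by move=> ?; left.
  - have [x xq] := atomP _ eta0; right; split; first exact/eqP.
    by split => //; rewrite -xq.
  - by move=> [[]|[]].
  - by move=> [[/eqP]|[_ []//]]; rewrite (negbTE eta0).
move=> eta eta0; rewrite (negbTE eta0).
rewrite (_ : [set _] = phi @^-1` [set q eta]); first exact: atom.
have [x xq] := atomP _ eta0.
rewrite -xq phiK; apply/seteqP; split => [_ -> //|y /= /(congr1 psi)].
by rewrite !phiK.
Qed.

End borel_spaces.

Lemma bounded_funP (T : Type) (R : realType) (f : T -> R) :
  bounded_fun f <-> exists M, forall x, `|f x| <= M.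
Proof.
split=> [[M [_ fM]]|[M fM]].
  by exists (M + 1) => x; apply: fM => //; rewrite ltrDl.
by exists M; split; [exact: num_real|move=> N MN x _; exact: le_trans (fM x) (ltW MN)].
Qed.

(** * Measurable enumeration of the points of a configuration *)

Section enumeration_of_atoms.
Context d (E : measurableType d) (R : realType).
Implicit Types (eta : Nfin E R) (s : seq E).
Context (mset1 : forall x : E, measurable [set x]).
Context (a : Nfin E R -> E).
Context (ma : measurable_fun setT a).
Context (aE : forall eta, eta setT != 0%E -> eta [set a eta] != 0%E).

(** Strong induction on the total mass: the chosen atom carries some [k > 0] units, and the rest of
    the configuration has smaller mass. *)
Lemma Nfin_diracs_mass m eta : eta setT = m%:R%:E -> exists s, eta = diracs R s.
Proof.
elim/ltn_ind: m eta => m IH eta etam.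
have [eta0|eta0] := eqVneq (eta setT) 0%E.
  exists [::]; apply: Nfin_ext => B mB; rewrite diracsE// big_nil -[RHS]/0%E.
  by apply/eqP; rewrite eq_le measure_ge0 andbT -eta0 le_measure ?inE.
set A := [set a eta]; have mA : measurable A by exact: mset1.
have [k etaA] := Nfin_nat eta mA.
have k0 : (0 < k)%N.
  by rewrite lt0n; have := aE eta0; rewrite -/A etaA eqe (eqr_nat R k 0).
have splitA B : measurable B -> (eta B = eta (B `&` A) + eta (B `&` ~` A))%E.
  move=> mB; rewrite -measureU//; [by rewrite -setIUr setUCr setIT| | |].
  - exact: measurableI.
  - by apply: measurableI => //; exact: measurableC.
  - by rewrite setIACA setICr setI0.
(* The outer [mres] resets the restricted measure to 0 on nonmeasurable sets, as membership in
   [Nfin] demands. *)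
pose mu := mres (mrestr eta (measurableC mA)).
have muE B : measurable B -> mu B = eta (B `&` ~` A) by move=> mB; rewrite /mu mresE.
have mu_nat B : measurable B -> exists l : nat, mu B = l%:R%:E.
  by move=> mB; rewrite muE//; apply: Nfin_nat; apply: measurableI => //; exact: measurableC.
have mu_non B : ~ measurable B -> mu B = 0%E by rewrite /mu /mres; case: asboolP.
pose eta' := MkNfin mu_nat mu_non.
have [l etal] := Nfin_nat eta' measurableT.
have mkl : m = (k + l)%N.
  have := splitA _ measurableT; rewrite -muE// -[mu _]/(eta' _) etal setTI etaA etam.
  by rewrite -EFinD -natrD => -[/eqP]; rewrite eqr_nat => /eqP.
have [|s eta's] := IH l _ eta' etal; first by rewrite mkl -[X in (X < _)%N]add0n ltn_add2r.
exists (nseq k (a eta) ++ s); apply: Nfin_ext => B mB.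
rewrite splitA// diracsE// big_cat EFinD.
rewrite -(@diracsE _ E R s B mB) -eta's -[eta' B]/(mu B) muE//.
congr (_ + _)%E; rewrite big_nseq iter_addr_0.
have [aB|aB] := pselect (B (a eta)).
  by rewrite mem_set// (_ : B `&` A = A)//; apply/setIidPr => _ ->.
rewrite memNset// mul0rn (_ : B `&` A = set0) ?measure0//.
by apply/seteqP; split => // x [Bx]; rewrite /A /= => xa; apply: aB; rewrite -xa.
Qed.

Lemma Nfin_diracs eta : exists s, eta = diracs R s.
Proof. by have [m] := Nfin_nat eta measurableT; exact: Nfin_diracs_mass. Qed.

Lemma diracs_points eta : diracs R (points eta) = eta.
Proof. by have [s ->] := Nfin_diracs eta; exact: points_diracs. Qed.

Lemma mem_atom s : (0 < size s)%N -> a (diracs R s) \in s.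
Proof.
move=> s0; have := @aE (diracs R s).
rewrite diracsT diracsE// eqe (eqr_nat R _ 0) -lt0n => /(_ s0).
apply: contra_neqT => as_; congr EFin; rewrite big_seq big1// => x xs.
by rewrite memNset//= => xa; move/negP: as_; apply; rewrite -xa.
Qed.

(** One copy of the chosen atom is deleted; the null configuration is left fixed, since [rem] does
    nothing on the empty list. *)
Definition strip eta := diracs R (rem (a eta) (points eta)).

Lemma measurable_strip : measurable_fun setT strip.
Proof.
apply: measurable_to_Nfin => B mB.
(* The maximum with 0 matters only for the null configuration, where [a eta] is not an atom. *)
rewrite (_ : (fun eta => _) =
  fun eta => maxe (eta B - (\1_B (a eta))%:E)%E 0%E); last first.
  apply/funext => eta; rewrite /strip diracsE//.
  have etap := diracs_points eta.
  rewrite -[in X in maxe (X _ - _)%E _]etap diracsE//.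
  case: (posnP (size (points eta))) => [/size0nil ->|p0].
    rewrite !big_nil -EFinB; apply/esym/max_idPr.
    by rewrite lee_fin sub0r oppr_le0 indicE ler0n.
  have ap : a eta \in points eta by rewrite -[in X in a X]etap mem_atom.
  rewrite (perm_big _ (perm_to_rem ap))/= big_cons indicE -EFinB addrAC subrr add0r.
  by apply/esym/max_idPl; rewrite lee_fin sumr_ge0.
apply: measurable_maxe => //; apply: emeasurable_funB; first exact: measurable_eval.
by apply/measurable_EFinP; apply: measurableT_comp => //; exact: measurable_indic.
Qed.

Definition atom i eta := a (iter i strip eta).

Lemma measurable_atom i : measurable_fun setT (atom i).
Proof.
apply: measurableT_comp => //; elim: i => [|i IH]; first exact: measurable_id.
by apply: (measurableT_comp measurable_strip).
Qed.

(** An enumeration only when [eta] has mass [m]; for other masses the tuple is truncated or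
    padded. *)
Definition atoms m eta := [tuple atom (i : 'I_m) eta | i < m].

Lemma measurable_atoms m : measurable_fun setT (atoms m).
Proof.
apply/measurable_fun_tnthP => i; rewrite (_ : _ \o _ = atom i).
  exact: measurable_atom.
by apply/funext => eta; rewrite /= tnth_mktuple.
Qed.

Lemma diracs_atoms m eta : eta setT = m%:R%:E -> diracs R (atoms m eta) = eta.
Proof.
have -> : atoms m eta = [seq atom i eta | i <- iota 0 m] :> seq E.
  by rewrite -val_enum_ord -map_comp.
have [s -> {eta}] := Nfin_diracs eta.
rewrite diracsT => -[/eqP]; rewrite eqr_nat => /eqP.
elim: m s => [|m IH] s sm; first by rewrite (size0nil sm).
have as_ : a (diracs R s) \in s by rewrite mem_atom// sm.
have sE : strip (diracs R s) = diracs R (rem (a (diracs R s)) s).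
  rewrite /strip; apply: perm_diracs.
  have ps := diracs_perm mset1 (points_diracs R s).
  rewrite -(perm_cons (a (diracs R s))) -(permPr (perm_to_rem as_)).
  by apply: perm_trans (ps); rewrite perm_sym perm_to_rem// (perm_mem ps).
rewrite [RHS](perm_diracs R (perm_to_rem as_)); apply: perm_diracs.
(* Shifting the index by one turns the later atoms of the configuration into the atoms of the
   stripped one, to which the induction hypothesis applies. *)
rewrite /= perm_cons (iotaDl 1 0) -map_comp; apply: (diracs_perm (R := R) mset1).
rewrite -[RHS]IH; last by rewrite size_rem// sm.
by congr diracs; apply: eq_map => i; rewrite -sE /atom -iterSr.
Qed.

(** Among configurations of the same mass, [eta] is determined by its tuple of atoms, and points of
    the tuple space are measurable. *)
Lemma measurable_Nfin1 eta : measurable [set eta].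
Proof.
have [m etam] := Nfin_nat eta measurableT.
rewrite (_ : [set eta] = [set zeta : Nfin E R | zeta setT = m%:R%:E] `&`
  (setT `&` atoms m @^-1` [set atoms m eta])).
  apply: measurableI; first exact: measurable_eval_eq.
  by apply: measurable_atoms => //; exact: measurable_tuple1.
rewrite setTI; apply/seteqP; split => [_ -> //|zeta /= [zetam zE]].
by rewrite -(diracs_atoms zetam) zE diracs_atoms.
Qed.

(** The witness [fn \o atoms n] rules out the default of [xget]: the atoms recover the tuple up to a
    permutation, which the symmetry of [fn] absorbs. *)
Lemma lift_NfinP n (fn : n.-tuple E -> R) : calF fn ->
  [/\ bounded_fun (lift_Nfin fn : Nfin E R -> R),
      measurable_fun setT (lift_Nfin fn : Nfin E R -> R)
    & forall x : n.-tuple E, fn x = lift_Nfin fn (diracs R x)].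
Proof.
move=> [bfn mfn sfn]; apply: (xgetPex (cst 0) (P := [set f : Nfin E R -> R |
  [/\ bounded_fun f, measurable_fun setT f &
   forall x : n.-tuple E, fn x = f (diracs R x)]])).
exists (fn \o atoms n); split.
- by move/bounded_funP : bfn => [M fM]; apply/bounded_funP; exists M => x; exact: fM.
- by apply: measurableT_comp => //; exact: measurable_atoms.
- move=> x /=; have /tuple_permP[p pE] : perm_eq (atoms n (diracs R x)) x.
    by apply: (diracs_perm (R := R) mset1); rewrite diracs_atoms// diracsT size_tuple.
  by rewrite -(sfn p); congr fn; exact/esym/val_inj.
Qed.

Lemma measurable_diracs d' (T : measurableType d') I (r : seq I) (F : I -> T -> E) :
  (forall i, measurable_fun setT (F i)) ->
  measurable_fun setT (fun t => diracs R [seq F i t | i <- r]).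
Proof.
move=> mF; apply: measurable_to_Nfin => B mB.
under eq_fun do rewrite diracsE// big_map.
apply/measurable_EFinP; apply: measurable_sum => i.
rewrite (_ : (fun t => _) = \1_B \o F i); last by apply/funext => t; rewrite /= indicE.
by apply: measurableT_comp => //; exact: measurable_indic.
Qed.

(** Lowering multiplies a bound by the mass of the configuration; confining functions to one mass
    keeps them bounded. *)
Definition supported_at m (g : Nfin E R -> R) :=
  [/\ bounded_fun g, measurable_fun setT g
    & forall eta, eta setT != m%:R%:E -> g eta = 0].

(** On mass [m.+1] the measurable enumeration writes [lowering g] as [m.+1] measurable terms, each
    bounded by the bound of [g]; elsewhere it vanishes. *)
Lemma supported_at_lowering m g : supported_at m g -> supported_at m.+1 (lowering g).
Proof.
move=> [/bounded_funP[M gM] mg g0].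
have lg0 eta : eta setT != m.+1%:R%:E -> lowering g eta = 0.
  have [s ->] := Nfin_diracs eta; rewrite diracsT eqe eqr_nat => sm.
  rewrite lowering_diracs// big_seq big1// => x xs; apply: g0.
  (* Since [x] is in [s], the list is nonempty and the predecessor of its size is a true one. *)
  rewrite diracsT size_rem// eqe eqr_nat; apply: contraNneq sm => <-.
  by case: s xs.
have lgE eta : eta setT = m.+1%:R%:E -> lowering g eta =
    \sum_(j < m.+1) g (diracs R [seq atom (lift j k) eta | k <- enum 'I_m]).
  move=> /diracs_atoms etaE.
  rewrite -[in LHS]etaE (lowering_codom mset1 g (fun i : 'I_m.+1 => atom i eta)).
  by apply: eq_bigr => j _; congr (g (diracs R _)).
split; last exact: lg0.
- apply/bounded_funP; exists (M *+ m.+1) => eta.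
  have M0 : 0 <= M by exact: le_trans (gM eta).
  have [etam|/lg0 ->] := eqVneq (eta setT) m.+1%:R%:E; last by rewrite normr0 mulrn_wge0.
  rewrite lgE// (le_trans (ler_norm_sum _ _ _))//.
  by rewrite -[X in _ <= M *+ X]card_ord -sumr_const ler_sum.
- rewrite (_ : lowering g = (fun eta => \1_[set eta : Nfin E R | eta setT = m.+1%:R%:E] eta *
    \sum_(j < m.+1) g (diracs R [seq atom (lift j k) eta | k <- enum 'I_m]))).
    apply: measurable_funM.
      by apply: measurable_indic; exact: measurable_eval_eq.
    apply: measurable_sum => j; apply: measurableT_comp => //.
    by apply: measurable_diracs => k; exact: measurable_atom.
  apply/funext => eta; rewrite indicE.
  have [etam|/eqP etam] := eqVneq (eta setT) m.+1%:R%:E.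
    by rewrite mem_set// mul1r lgE.
  by rewrite memNset// mul0r lg0//; exact/eqP.
Qed.

Lemma supported_at_iter_lowering n k g : supported_at n g ->
  supported_at (k + n) (iter k (@lowering d E R) g).
Proof. by move=> gn; elim: k => //= k; exact: supported_at_lowering. Qed.

End enumeration_of_atoms.

(** * The semigroup of a conservative process *)

Section markov_processes.
Context d (E : measurableType d) (R : realType) d' (Omega : measurableType d').
Context (X : R -> Omega -> Nfin E R) (P : Nfin E R -> probability Omega R).
Context (hX : is_markov_process X P).

(** Under [P eta] the process almost surely starts at [eta] and keeps its mass, so [f \o X t] and
    [g \o X t] agree almost surely. No bound is asked of [f] and [g], so unbounded functions such as
    [J fn] are covered. *)
Lemma semigroup_conservative (f g : Nfin E R -> R) t (eta : Nfin E R) :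
  conservative X P -> measurable [set eta] -> 0 <= t ->
  measurable_fun setT f -> measurable_fun setT g ->
  (forall zeta : Nfin E R, zeta setT = eta setT -> f zeta = g zeta) ->
  semigroup X P t f eta = semigroup X P t g eta.
Proof.
move=> hcons meta t0 mf mg fg; rewrite /semigroup unlock; congr fine.
have mXt := markov_measurable hX t0.
apply: ae_eq_integral => //.
- by apply/measurable_EFinP; exact: measurableT_comp.
- by apply/measurable_EFinP; exact: measurableT_comp.
have mX0 : measurable [set w | X 0 w = eta].
  rewrite -[X in measurable X]setTI.
  exact: (markov_measurable hX (lexx 0) measurableT meta).
have ae0 : {ae P eta, forall w, X 0 w = eta}.
  exists (~` [set w | X 0 w = eta]); split => //; first exact: measurableC.
  by rewrite probability_setC// (markov_initial hX) subee.
have aet := hcons eta t t0; near=> w => _ /=; congr EFin; apply: fg.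
have X0 : X 0 w = eta by near: w.
by rewrite -[in RHS]X0; near: w.
Unshelve. all: by end_near. Qed.

Lemma semigroup_cst c t eta : semigroup X P t (cst c) eta = c.
Proof. by rewrite /semigroup (_ : cst c \o _ = cst c)// expectation_cst. Qed.

Lemma semigroupZ c (f : Nfin E R -> R) t eta : 0 <= t ->
  bounded_fun f -> measurable_fun setT f ->
  semigroup X P t (fun zeta => c * f zeta) eta = c * semigroup X P t f eta.
Proof.
move=> t0 /bounded_funP[M fM] mf; rewrite /semigroup unlock.
apply: (RintegralZl (mu := P eta) (f := f \o X t) c measurableT).
apply: measurable_bounded_integrable => //.
- exact: le_lt_trans (probability_le1 _ _) (ltry _).
- by apply: measurableT_comp => //; exact: markov_measurable hX _ t0.
- by apply/bounded_funP; exists M => w; exact: fM.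
Qed.

End markov_processes.

(** * The intertwining relation *)

Theorem theorem3p5 (R : realType) (d : measure_display) (E : measurableType d)
    (d' : measure_display) (Omega : measurableType d')
    (X : R -> Omega -> Nfin E R) (P : Nfin E R -> probability Omega R)
    (hE : borel_space R E) (hX : is_markov_process X P)
    (hconsistent : consistent X P) (hconservative : conservative X P)
    (n : nat) (fn : n.-tuple E -> R) (hfn : calF fn)
    (t : R) (ht : 0 <= t) (eta : Nfin E R) :
  semigroup X P t (J fn) eta = J (particle_semigroup X P t fn) eta.
Proof.
have [n0|n0] := posnP n.
  by subst n; exact: semigroup_cst.
have mset1 := borel_space_measurable1 hE.
have [a [ma aE]] := borel_space_atom hE.
have Neta := Nfin_diracs mset1 aE.
have [bl ml fnE] := lift_NfinP mset1 ma aE hfn.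
pose N m := [set zeta : Nfin E R | zeta setT = m%:R%:E].
have mN m : measurable (N m) by exact: measurable_eval_eq.
(* The lift is unconstrained off mass [n]; the cutoff makes the iterated lowerings bounded. *)
pose h zeta := lift_Nfin fn zeta * \1_(N n) zeta.
have hn : supported_at n h.
  split.
  - move/bounded_funP : bl => [M lM]; apply/bounded_funP; exists M => zeta.
    rewrite /h indicE; case: (_ \in _); first by rewrite mulr1.
    by rewrite mulr0 normr0; exact: le_trans (lM zeta).
  - by apply: measurable_funM => //; exact: measurable_indic.
  - by move=> zeta /eqP zn; rewrite /h indicE memNset// mulr0.
have h_lift (zeta : Nfin E R) : zeta setT = n%:R%:E -> h zeta = lift_Nfin fn zeta.
  by move=> zn; rewrite /h indicE mem_set// mulr1.
have hE' (y : n.-tuple E) : fn y = h (diracs R y).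
  by rewrite h_lift ?diracsT ?size_tuple.
have pE (y : n.-tuple E) :
    particle_semigroup X P t fn y = semigroup X P t h (diracs R y).
  transitivity (semigroup X P t (lift_Nfin fn) (diracs R y)).
    (* [particle_semigroup] reduces only once [n] is a visible successor. *)
    by case: n n0 fn {hfn bl ml fnE N mN h hn h_lift hE'} y.
  apply: (semigroup_conservative hX) => //.
  - exact: (measurable_Nfin1 mset1 ma aE).
  - by case: hn.
  - by move=> zeta; rewrite diracsT size_tuple => /h_lift.
pose c k : R := n`!%:R / k`!%:R.
have JE k (zeta : Nfin E R) : zeta setT = (k + n)%:R%:E ->
    J fn zeta = c k * iter k (@lowering d E R) h zeta.
  have [s ->] := Neta zeta; rewrite diracsT => -[/eqP]; rewrite eqr_nat => /eqP.
  exact: J_lowering.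
have J0 m (zeta : Nfin E R) : (m < n)%N -> zeta setT = m%:R%:E -> J fn zeta = 0.
  have [s ->] := Neta zeta; rewrite diracsT => mn -[/eqP]; rewrite eqr_nat => /eqP sm.
  by rewrite J_small// sm.
have supp k := supported_at_iter_lowering mset1 ma aE k hn.
(* Pieced together over the countably many levels [N m]: zero below [n], a multiple of an iterated
   lowering of [h] from [n] on. *)
have mJ : measurable_fun setT (J fn).
  have NT : [set: Nfin E R] = \bigcup_m N m.
    by apply/seteqP; split => // zeta _; have [m] := Nfin_nat zeta measurableT; exists m.
  rewrite NT; apply/measurable_fun_bigcup => // m.
  have [mn|nm] := ltnP m n.
    apply: (eq_measurable_fun (cst 0 : Nfin E R -> R)) => // zeta; rewrite inE => zm.
    by rewrite (J0 m).
  apply: (eq_measurable_fun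
    (fun zeta : Nfin E R => c (m - n)%N * iter (m - n) (@lowering d E R) h zeta)).
    by move=> zeta; rewrite inE => zm; rewrite (JE (m - n)%N)// subnK.
  apply: measurable_funTS; apply: measurable_funM => //.
  by case: (supp (m - n)%N).
have comm k : semigroup X P t (iter k (@lowering d E R) h) =
    iter k (@lowering d E R) (semigroup X P t h).
  elim: k => //= k <-; apply/funext => zeta.
  by have [bk mk _] := supp k; exact: hconsistent.
have [m etam] := Nfin_nat eta measurableT.
have meta := measurable_Nfin1 mset1 ma aE eta.
have [s etas] := Neta eta.
have sm : size s = m.
  by move: etam; rewrite etas diracsT => -[/eqP]; rewrite eqr_nat => /eqP.
have [mn|nm] := ltnP m n.
  (* With fewer than [n] points the right side is 0, rewritten as the semigroup of the constant 0,
     and [J fn] vanishes on the whole level of [eta]. *)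
  rewrite etas J_small ?sm// -[RHS](semigroup_cst X P _ t eta) -etas.
  by apply: (semigroup_conservative hX) => // zeta; rewrite etam; exact: J0.
have mE : m = (m - n + n)%N by rewrite subnK.
have [bk mk _] := supp (m - n)%N.
(* By [pE], [J_lowering] also applies to the particle semigroup, with [semigroup X P t h] in place
   of [h]. *)
rewrite [in RHS]etas (J_lowering mset1 n0 pE (k := m - n)) ?sm//.
rewrite -etas -comm -(semigroupZ hX) //.
apply: (semigroup_conservative hX) => //; first exact: measurable_funM.
by move=> zeta; rewrite etam {1}mE; exact: JE.
Qed.
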